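(* Let $X$ be a separable reflexive real Banach space. (i) Let $n\ge 1$ and let $\|\cdot\|$ be any norm on the $n$-fold exterior product $\bigwedge^n X$. Then $$\|(x_1,\ldots,x_n)\|:=\|x_1\wedge\cdots\wedge x_n\|,\qquad (x_1,\ldots,x_n)\in X^n,$$ defines an $n$-norm on $X$. (ii) Let $n\ge 2$ and let $\|\cdot\|$ be any norm on the $(n-1)$-fold exterior product $\bigwedge^{n-1}X$. Then $$d(x_1,\ldots,x_n)=\|(x_2-x_1)\wedge(x_3-x_1)\wedge\cdots\wedge(x_n-x_1)\|,\qquad (x_1,\ldots,x_n)\in X^n,$$ defines a pseudo $n$-metric on $X$. Moreover $d(x_1,\ldots,x_n)=0$ if and only if the vectors $x_i-x_1$, $i=2,\ldots,n$, are linearly dependent.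
   Context: Exterior product: for a separable reflexive real Banach space $X$ with dual $X^\star$ and $x_1,\ldots,x_k\in X$, the element $x_1\wedge\cdots\wedge x_k$ is the continuous alternating $k$-linear form on $X^\star$ given by $(f_1,\ldots,f_k)\mapsto\det\big(\langle f_i,x_j\rangle\big)_{i,j=1}^k$. The space $\bigwedge^kX$ is the closure of the linear span of these elements in the space of continuous alternating $k$-linear forms on $X^\star$ with respect to the norm $\|\Phi\|_\wedge=\sup\{|\Phi(f_1,\ldots,f_k)|: f_j\in X^\star,\ \|f_j\|_{X^\star}=1\}$. Pseudo $n$-norm: for a real vector space $X$, a map $\|\cdot\|:X^n\to\mathbb{R}$ is a pseudo $n$-norm if (i) $\|(x_1,\ldots,x_n)\|=0$ whenever $x_1,\ldots,x_n$ are linearly dependent; (ii) $\|(x_{\pi(1)},\ldots,x_{\pi(n)})\|=\|(x_1,\ldots,x_n)\|$ for all permutations $\pi$ of $\{1,\ldots,n\}$; (iii) $\|(\lambda x_1,x_2,\ldots,x_n)\|=|\lambda|\,\|(x_1,\ldots,x_n)\|$ for all $\lambda\in\mathbb{R}$; (iv) $\|(x_1+y,x_2,\ldots,x_n)\|\le\|(x_1,x_2,\ldots,x_n)\|+\|(y,x_2,\ldots,x_n)\|$ for all $x_1,\ldots,x_n,y\in X$. It is an $n$-norm if $\|(x_1,\ldots,x_n)\|=0$ holds if and only if $x_1,\ldots,x_n$ are linearly dependent. Pseudo $n$-metric: for $n\ge2$ and a set $X$, a map $d:X^n\to\mathbb{R}$ is a pseudo $n$-metric on $X$ if (i) $d(x_1,\ldots,x_n)=0$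 whenever $x_i=x_j$ for some $i\ne j$; (ii) $d(x_{\pi(1)},\ldots,x_{\pi(n)})=d(x_1,\ldots,x_n)$ for all permutations $\pi$ of $\{1,\ldots,n\}$; (iii) $d(x_1,\ldots,x_n)\le\sum_{i=1}^n d(x_1,\ldots,x_{i-1},y,x_{i+1},\ldots,x_n)$ for all $x_1,\ldots,x_n,y\in X$. *)

(* Defs.v *)
From HB Require Import structures.
From mathcomp Require Import all_boot all_order all_algebra perm.
From mathcomp Require Import all_classical all_reals all_analysis.

Set Implicit Arguments.
Unset Strict Implicit.
Unset Printing Implicit Defensive.

Import Order.TTheory GRing.Theory Num.Theory.
Import numFieldNormedType.Exports.

Local Open Scope classical_set_scope.
Local Open Scope ring_scope.

Definition separable_space (T : topologicalType) :=
  exists2 A : set T, countable A & dense A.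

Section LinearAlgebra.
Context {R : realType} {V : lmodType R}.

Definition lin_dependent n (x : 'I_n -> V) :=
  exists a : 'I_n -> R, (exists i, a i != 0) /\ \sum_i a i *: x i = 0.

Definition lin_span (S : set V) : set V :=
  [set v | exists n (a : 'I_n -> R) (s : 'I_n -> V),
     (forall i, S (s i)) /\ v = \sum_i a i *: s i].

(* Nonnegativity follows from these axioms. *)
Record is_norm (N : V -> R) : Prop := IsNorm {
  is_norm_triangle : forall u v, N (u + v) <= N u + N v ;
  is_norm_scale : forall a v, N (a *: v) = `|a| * N v ;
  is_norm_definite : forall v, N v = 0 -> v = 0 }.

Lemma lin_span0 S : lin_span S 0.
Proof.
exists 0%N, (fun=> 0), (fun=> 0); split; first by case.
by rewrite big_ord0.
Qed.

Lemma lin_span_linear S a u v :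
  lin_span S u -> lin_span S v -> lin_span S (a *: u + v).
Proof.
move=> [n [b [s [Ss ->]]]] [m [c [t [St ->]]]].
exists (n + m)%N,
  (fun i => match fintype.split i with inl j => a * b j | inr j => c j end),
  (fun i => match fintype.split i with inl j => s j | inr j => t j end).
split; first by move=> i; case: (fintype.split i).
rewrite big_split_ord/= scaler_sumr; congr (_ + _); apply: eq_bigr => i _.
  by rewrite (unsplitK (inl i)) scalerA.
by rewrite (unsplitK (inr i)).
Qed.

Lemma sub_lin_span S v : S v -> lin_span S v.
Proof.
by move=> Sv; exists 1%N, (fun=> 1), (fun=> v); rewrite big_ord1 scale1r.
Qed.

End LinearAlgebra.

Section SupAbs.
Context {R : realType} {T : Type}.
Implicit Types (A : set T) (f g : T -> R).

Definition sup_abs A f : R := sup [set `|f x| | x in A].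

Lemma sup_abs_le A f c : 0 <= c -> (forall x, A x -> `|f x| <= c) ->
  sup_abs A f <= c.
Proof.
move=> c0 fc; rewrite /sup_abs; have [->|/set0P[x Ax]] := eqVneq A set0.
  by rewrite image_set0 sup0.
apply: ge_sup; first by exists `|f x|, x.
by move=> _ [y Ay <-]; exact: fc.
Qed.

Lemma sup_abs_ub A f c : (forall x, A x -> `|f x| <= c) ->
  forall x, A x -> `|f x| <= sup_abs A f.
Proof.
move=> fc x Ax; apply: ub_le_sup; last by exists x.
by exists c => _ [y Ay <-]; exact: fc.
Qed.

Lemma sup_abs_ge0 A f : 0 <= sup_abs A f.
Proof.
rewrite /sup_abs; have [[_ ub]|/sup_out->//] := pselect (has_sup [set `|f x| | x in A]).
have [->|/set0P[x Ax]] := eqVneq A set0; first by rewrite image_set0 sup0.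
by apply: (le_trans (normr_ge0 (f x))); apply: ub_le_sup => //; exists x.
Qed.

Lemma sup_absD A f g : (exists c, forall x, A x -> `|f x| <= c) ->
  (exists c, forall x, A x -> `|g x| <= c) ->
  sup_abs A (fun x => f x + g x) <= sup_abs A f + sup_abs A g.
Proof.
move=> [c fc] [d gd]; apply: sup_abs_le => [|x Ax].
  by rewrite addr_ge0// sup_abs_ge0.
by rewrite (le_trans (ler_normD _ _))// lerD//; [exact: sup_abs_ub fc _ Ax|
  exact: sup_abs_ub gd _ Ax].
Qed.

Lemma sup_absZ A f a : (exists c, forall x, A x -> `|f x| <= c) ->
  sup_abs A (fun x => a * f x) = `|a| * sup_abs A f.
Proof.
move=> [c fc]; have [->|a0] := eqVneq a 0.
  rewrite normr0 mul0r; apply/eqP; rewrite eq_le sup_abs_ge0 andbT.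
  by apply: sup_abs_le => // x _; rewrite mul0r normr0.
apply/eqP; rewrite eq_le; apply/andP; split.
  apply: sup_abs_le => [|x Ax]; first by rewrite mulr_ge0// sup_abs_ge0.
  by rewrite normrM ler_wpM2l//; exact: sup_abs_ub fc _ Ax.
rewrite mulrC -ler_pdivlMr ?normr_gt0//; apply: sup_abs_le => [|x Ax].
  by rewrite divr_ge0// sup_abs_ge0.
rewrite ler_pdivlMr ?normr_gt0// mulrC -normrM.
apply: (@sup_abs_ub A (fun x => a * f x) (`|a| * c)) => // y Ay.
by rewrite normrM ler_wpM2l// fc.
Qed.

End SupAbs.

Section Dual.
Context {R : realType} (X : normedModType R).

Definition clinear : {pred X -> R} :=
  mem [set f : X -> R | linear f /\ continuous f].

Record dual_space := Dual { dual_fun :> X -> R ; _ : dual_fun \in clinear }.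

Implicit Types (f g : dual_space) (x : X).

HB.instance Definition _ := [isSub for dual_fun].
HB.instance Definition _ := [Choice of dual_space by <:].

Lemma clinear_submod_closed : submod_closed clinear.
Proof.
split.
  rewrite inE/=; split; last exact: cst_continuous.
  by move=> a u v; rewrite /= scaler0 addr0.
move=> a f g /[!inE] -[lf cf] [lg cg]; split.
  move=> b u v; rewrite !fctE lf lg !scalerDr !scalerA (mulrC a b).
  by rewrite !addrA; congr (_ + _); rewrite -!addrA; congr (_ + _); rewrite addrC.
move=> x; apply: cvgD; last exact: cg.
by apply: cvgZr; exact: cf.
Qed.

HB.instance Definition _ :=
  GRing.isSubmodClosed.Build R (X -> R) clinear clinear_submod_closed.
HB.instance Definition _ := [SubChoice_isSubLmodule of dual_space by <:].

Lemma dual_linear (f : dual_space) : linear f.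
Proof. by have := valP f; rewrite inE => -[]. Qed.

Lemma dual_continuous (f : dual_space) : continuous f.
Proof. by have := valP f; rewrite inE => -[]. Qed.

HB.instance Definition _ (f : dual_space) :=
  GRing.isLinear.Build R X R *:%R f (dual_linear f).

Definition dual_norm (f : dual_space) : R := sup_abs [set x | `|x| <= 1] f.

Lemma dualDE (f g : dual_space) x : (f + g) x = f x + g x. Proof. by []. Qed.
Lemma dualZE a (f : dual_space) x : (a *: f) x = a * f x. Proof. by []. Qed.

Lemma dual_bounded (f : dual_space) :
  exists c, forall x, `|x| <= 1 -> `|f x| <= c.
Proof.
have /linear_bounded_continuous/bounded_funP/(_ 1) := @dual_continuous f.
exact.
Qed.

Lemma dual_norm_triangle f g : dual_norm (f + g) <= dual_norm f + dual_norm g.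
Proof. by apply: sup_absD; exact: dual_bounded. Qed.

Lemma dual_norm_scale a f : dual_norm (a *: f) = `|a| * dual_norm f.
Proof. by apply: sup_absZ; exact: dual_bounded. Qed.

Lemma dual_norm_bound f x : `|f x| <= dual_norm f * `|x|.
Proof.
have [->|x0] := eqVneq x 0; first by rewrite linear0 !normr0 mulr0.
have nx : 0 < `|x| by rewrite normr_gt0.
have [c fc] := dual_bounded f.
have : `|f (`|x|^-1 *: x)| <= dual_norm f.
  apply: (sup_abs_ub fc) => /=.
  by rewrite normrZ normfV normr_id mulVf// gt_eqF.
by rewrite linearZ/= normrZ normfV normr_id mulrC ler_pdivrMr.
Qed.

Lemma dual_norm_definite f : dual_norm f = 0 -> f = 0.
Proof.
move=> f0; apply/val_inj/funext => x /=; apply/eqP; rewrite -normr_le0.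
by rewrite (le_trans (dual_norm_bound f x))// f0 mul0r.
Qed.

HB.instance Definition _ := Lmodule_isNormed.Build R dual_space
  dual_norm_triangle dual_norm_scale dual_norm_definite.

Lemma dual_normM f x : `|f x| <= `|f| * `|x|.
Proof. exact: dual_norm_bound. Qed.

End Dual.

Definition reflexive_space {R : realType} (X : normedModType R) :=
  forall phi : dual_space (dual_space X), exists x : X,
    forall f : dual_space X, phi f = f x.

Section Exterior.
Context {R : realType} (k : nat) (X : normedModType R).
Local Notation forms := (('I_k -> dual_space X) -> R).
Implicit Types (f : 'I_k -> dual_space X) (Phi : forms) (x : 'I_k -> X).

(* [eta f with i |-> g] is the family f with its i-th member replaced by g. *)
Definition multilinear Phi :=
  forall (i : 'I_k) f, scalar (fun g : dual_space X => Phi [eta f with i |-> g]).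

Definition alternating_form Phi :=
  forall f (i j : 'I_k), i != j -> f i = f j -> Phi f = 0.

(* {ptws 'I_k -> dual_space X} is (X^* )^k with the product of the norm
   topologies of X^*. *)
Definition altform_pred : {pred forms} :=
  mem [set Phi : forms | [/\ multilinear Phi, alternating_form Phi &
    continuous (Phi : {ptws 'I_k -> dual_space X} -> R)]].

Record altform := AltForm {
  altform_fun :> forms ; _ : altform_fun \in altform_pred }.

HB.instance Definition _ := [isSub for altform_fun].
HB.instance Definition _ := [Choice of altform by <:].

Lemma altform_submod_closed : submod_closed altform_pred.
Proof.
split.
  rewrite inE/=; split => //; last exact: cst_continuous.
  have z f : (0 : forms) f = 0 by [].
  by move=> i f a u v; rewrite !z mulr0 addr0.
move=> a P Q /[!inE] -[mP aP cP] [mQ aQ cQ].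
have E h : (a *: P + Q) h = a * P h + Q h by [].
split.
- by move=> i f b u v; rewrite !E mP mQ !mulrDr !mulrA (mulrC b a) addrACA.
- move=> f i j ij fij; rewrite E (aP f i j)// (aQ f i j)//.
  by rewrite mulr0 addr0.
- move=> f; apply: (@cvgD _ _ {ptws 'I_k -> dual_space X} (nbhs f) _ (a *: P) Q);
    last exact: cQ.
  by apply: cvgZr; exact: cP.
Qed.

HB.instance Definition _ :=
  GRing.isSubmodClosed.Build R forms altform_pred altform_submod_closed.
HB.instance Definition _ := [SubChoice_isSubLmodule of altform by <:].

Lemma altformP (Phi : altform) : [/\ multilinear Phi, alternating_form Phi &
  continuous (Phi : {ptws 'I_k -> dual_space X} -> R)].
Proof. by have := valP Phi; rewrite inE. Qed.

Lemma multilinear_scale Phi (a : 'I_k -> R) f : multilinear Phi ->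
  Phi (fun j => a j *: f j) = (\prod_j a j) * Phi f.
Proof.
move=> mP.
suff H (s : seq 'I_k) : uniq s ->
    Phi (fun j => if j \in s then a j *: f j else f j) = \prod_(j <- s) a j * Phi f.
  have := H (index_enum 'I_k) (index_enum_uniq _).
  by move=> <-; congr Phi; apply/funext => j; rewrite mem_index_enum.
elim: s => [_|i s IH /= /andP[si us]].
  by rewrite big_nil mul1r; congr Phi; apply/funext.
rewrite big_cons -mulrA -IH//.
set h := fun j => if j \in s then _ else _.
have upd v g : (forall j, g j = if j == i then v else h j) ->
    Phi [eta h with i |-> v] = Phi g.
  by move=> gE; congr Phi; apply/funext => j; rewrite gE.
have hi : h i = f i by rewrite /h (negbTE si).
have h0 : Phi [eta h with i |-> 0] = 0.
  have /= := mP i h 1 0 0; rewrite scale1r addr0 mul1r => /esym/eqP.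
  by rewrite -subr_eq0 addrK => /eqP.
have /= := mP i h (a i) (f i) 0; rewrite addr0 h0 addr0.
rewrite (upd (f i) h); last by move=> j; case: eqP => // ->.
move=> <-; apply/esym/upd => j; rewrite inE.
by case: eqP => [->|].
Qed.

Lemma altform_bounded (Phi : altform) :
  exists c, forall f, (forall j, `|f j| = 1) -> `|Phi f| <= c.
Proof.
have [mP _ cP] := altformP Phi.
pose F : set_system {ptws 'I_k -> dual_space X} := fun W =>
  \forall d \near 0^'+, forall f, (forall j, `|f j| <= d) -> W f.
have FF : Filter F.
  split.
  - by apply: (@filterE _ (0^'+)) => d f _.
  - move=> A B; apply: (@filterS2 _ (0^'+)) => d HA HB f fd.
    by split; [exact: HA|exact: HB].
  - by move=> A B AB; apply: (@filterS _ (0^'+)) => d HA f fd; apply/AB/HA.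
have F0 : {ptws, F --> (fun=> 0 : dual_space X)}.
  apply/cvg_sup => t; apply/cvg_image.
    by rewrite eqEsubset; split => v // _; exists (cst v).
  move=> W /nbhs_norm0P[e /= e0 eW].
  exists [set f | W (f t)]; last first.
    by rewrite eqEsubset; split => [j [? + <-//]|j Wj]; exists (fun=> j).
  have : \forall d \near 0^'+, d < e :> R by exact: nbhs_right_lt.
  by apply: (@filterS _ (0^'+)) => d de f fd; apply: eW => /=; exact: le_lt_trans (fd t) de.
have := cvg_trans (cvg_app Phi F0) (cP (fun=> 0)).
move=> /cvgrPdist_lt/(_ 1 ltr01)/= FPhi.
have [d [d0 H]] : exists d : R, 0 < d /\ forall f, (forall j, `|f j| <= d) ->
    `|Phi (fun=> 0) - Phi f| < 1.
  have P : \forall d \near (0 : R)^'+, 0 < d by exact: nbhs_right_gt.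
  have Q : \forall d \near (0 : R)^'+, forall f, (forall j, `|f j| <= d) ->
    `|Phi (fun=> 0) - Phi f| < 1 by exact: FPhi.
  have [d [d0 H]] := @filter_ex _ _ _ _ (@filterI _ (0^'+) _ _ _ P Q).
  by exists d.
exists ((`|Phi (fun=> 0)| + 1) / d ^+ k) => f f1.
rewrite ler_pdivlMr ?exprn_gt0//.
have /H : forall j, `|(fun j => d *: f j) j| <= d.
  by move=> j; rewrite /= normrZ f1 mulr1 gtr0_norm.
rewrite (multilinear_scale (fun=> d))// prodr_const card_ord => /ltW Hd.
have -> : `|Phi f| * d ^+ k = `|d ^+ k * Phi f|.
  by rewrite normrM mulrC (ger0_norm (exprn_ge0 _ (ltW d0))).
by rewrite -lerBlDl (le_trans _ Hd)// distrC lerB_dist.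
Qed.

(* The norm of the exterior power: the supremum is over an empty set, hence 0,
   only if k > 0 and X^* = 0, in which case the only form is 0. *)
Definition altform_norm (Phi : altform) : R :=
  sup_abs [set f | forall j, `|f j| = 1] Phi.

Lemma altform_norm_triangle (Phi Psi : altform) :
  altform_norm (Phi + Psi) <= altform_norm Phi + altform_norm Psi.
Proof. by apply: sup_absD; exact: altform_bounded. Qed.

Lemma altform_norm_scale a (Phi : altform) :
  altform_norm (a *: Phi) = `|a| * altform_norm Phi.
Proof. by apply: sup_absZ; exact: altform_bounded. Qed.

Lemma altform_norm_definite (Phi : altform) : altform_norm Phi = 0 -> Phi = 0.
Proof.
move=> P0; apply/val_inj/funext => f /=; rewrite [RHS]/(0 : R).
have [mP _ _] := altformP Phi.
have [c Pc] := altform_bounded Phi.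
have {1}-> : f = (fun j => `|f j| *: (`|f j|^-1 *: f j)).
  apply/funext => j; have [->|fj0] := eqVneq (f j) 0; first by rewrite !scaler0.
  by rewrite scalerA mulfV ?scale1r// normr_eq0.
rewrite (multilinear_scale (fun j => `|f j|))//.
have [/forallP fn0|/forallPn[j /negPn/eqP fj0]] := boolP [forall j, f j != 0]; last first.
  by rewrite (bigD1 j)//= fj0 normr0 !mul0r.
pose g j := `|f j|^-1 *: f j; suff -> : Phi g = 0 by rewrite mulr0.
apply/eqP; rewrite -normr_le0 -P0; apply: (sup_abs_ub Pc) => j.
by rewrite /g normrZ normfV normr_id mulVf// normr_eq0.
Qed.

HB.instance Definition _ := Lmodule_isNormed.Build R altform
  altform_norm_triangle altform_norm_scale altform_norm_definite.

Lemma cvg_eval (i : 'I_k) (y : X) (f : {ptws 'I_k -> dual_space X}) :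
  (fun g : {ptws 'I_k -> dual_space X} => g i y) @ f --> f i y.
Proof.
move=> A; rewrite nbhs_simpl => /nbhs_normP[e /= e0 eA].
have c0 : 0 < `|y| + 1 by rewrite ltr_wpDl.
have ec0 : 0 < e / (`|y| + 1) by rewrite divr_gt0.
have H : nbhs (f i) [set h | `|f i - h| < e / (`|y| + 1)].
  by have := @nbhsx_ballx _ _ (f i) _ ec0; rewrite -ball_normE; exact.
have {}H : nbhs f [set g : {ptws 'I_k -> dual_space X} |
    `|f i - g i| < e / (`|y| + 1)].
  exact: (@proj_continuous _ (fun=> dual_space X) i f _ H).
apply: (@filterS _ (nbhs f) _ _ _ _ H) => g fg; apply: eA.
change (`|f i y - g i y| < e).
have -> : f i y - g i y = (f i - g i) y by [].
apply: le_lt_trans (dual_normM (f i - g i) y) _.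
rewrite (@le_lt_trans _ _ (`|f i - g i| * (`|y| + 1)))//.
  by rewrite ler_wpM2l// lerDl.
by rewrite -ltr_pdivlMr.
Qed.

Lemma continuous_det (x : 'I_k -> X) :
  continuous (fun f : {ptws 'I_k -> dual_space X} =>
    \det (\matrix_(i < k, j < k) f i (x j)) : R).
Proof.
move=> f.
have E (g : {ptws 'I_k -> dual_space X}) : \det (\matrix_(i < k, j < k) g i (x j)) =
   \sum_(s : 'S_k) (-1) ^+ s * \prod_i g i (x (s i)).
  rewrite /determinant; apply: eq_bigr => s _; congr (_ * _).
  by apply: eq_bigr => i _; rewrite mxE.
rewrite /continuous_at E (eq_cvg _ _ E).
apply: (@cvg_big R _ +%R 0 xpredT (@add_continuous R) _ (nbhs f)) => s _.
apply: cvgMl_tmp.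
apply: (@cvg_big R _ *%R 1 xpredT (@mul_continuous R) _ (nbhs f)) => i _.
exact: cvg_eval.
Qed.

Lemma extprod_subproof x :
  (fun f => \det (\matrix_(i < k, j < k) f i (x j))) \in altform_pred.
Proof.
rewrite inE/=; split.
- move=> i f a u v /=.
  rewrite -[X in _ = _ + X]mul1r.
  apply: (@determinant_multilinear _ _ _ _ _ i).
  + by apply/rowP => j; rewrite !mxE/= eqxx mul1r.
  + by apply/matrixP => p q; rewrite !mxE/= eq_sym (negbTE (neq_lift _ _)).
  + by apply/matrixP => p q; rewrite !mxE/= eq_sym (negbTE (neq_lift _ _)).
- move=> f i j ij fij; apply: (determinant_alternate ij) => q.
  by rewrite !mxE fij.
- exact: continuous_det.
Qed.

Definition extprod_form x : altform := AltForm (extprod_subproof x).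

Definition ext_pred : {pred altform} :=
  mem (closure (lin_span (range extprod_form))).

(* The closure is taken in the normed space altform, i.e. with respect to
   altform_norm. *)
Record extpow := ExtPow { extpow_val :> altform ; _ : extpow_val \in ext_pred }.

HB.instance Definition _ := [isSub for extpow_val].
HB.instance Definition _ := [Choice of extpow by <:].

Lemma ext_submod_closed : submod_closed ext_pred.
Proof.
have cl v : v \in ext_pred <-> forall e : R, 0 < e ->
    exists2 s, lin_span (range extprod_form) s & `|v - s| < e.
  rewrite inE; split=> [clv e e0|H B /nbhs_normP[e /= e0 eB]].
    have [s [Ss vs]] := clv _ (nbhsx_ballx v e e0).
    by exists s => //; move: vs; rewrite -ball_normE.
  by have [s Ss vs] := H e e0; exists s; split => //; exact: eB.
split.
  apply/cl => e e0; exists 0; first exact: lin_span0.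
  by rewrite subrr normr0.
move=> a u v /cl clu /cl clv; apply/cl => e e0.
have a1 : 0 < `|a| + 1 by rewrite ltr_wpDl.
have [|s Ss us] := clu (e / 2 / (`|a| + 1)); first by rewrite !divr_gt0.
have [|t St vt] := clv (e / 2); first by rewrite divr_gt0.
exists (a *: s + t); first exact: lin_span_linear.
have -> : a *: u + v - (a *: s + t) = a *: (u - s) + (v - t).
  by rewrite scalerBr opprD addrACA.
rewrite (le_lt_trans (ler_normD _ _))// [ltRHS](splitr e) ltr_leD//; last exact: ltW.
rewrite normrZ.
rewrite (@le_lt_trans _ _ ((`|a| + 1) * `|u - s|))//.
  by rewrite ler_wpM2r// lerDl.
by rewrite mulrC -ltr_pdivlMr.
Qed.

HB.instance Definition _ :=
  GRing.isSubmodClosed.Build R altform ext_pred ext_submod_closed.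
HB.instance Definition _ := [SubChoice_isSubLmodule of extpow by <:].

Lemma extprod_in_ext x : extprod_form x \in ext_pred.
Proof.
by rewrite inE; apply/subset_closure/sub_lin_span; exists x.
Qed.

Definition extprod x : extpow := ExtPow (extprod_in_ext x).

End Exterior.

Section NNorm.
Context {R : realType}.

(* The conditions on i single out the first argument. *)
Record pseudo_nnorm (V : lmodType R) n (N : ('I_n -> V) -> R) : Prop :=
  PseudoNNorm {
  pseudo_nnorm_dep : forall x, lin_dependent x -> N x = 0 ;
  pseudo_nnorm_perm : forall x (s : 'S_n), N (fun i => x (s i)) = N x ;
  pseudo_nnorm_scale : forall x (i : 'I_n) (a : R), i = 0 :> nat ->
    N [eta x with i |-> a *: x i] = `|a| * N x ;
  pseudo_nnorm_triangle : forall x (i : 'I_n) y, i = 0 :> nat ->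
    N [eta x with i |-> x i + y] <= N x + N [eta x with i |-> y] }.

Definition is_nnorm (V : lmodType R) n (N : ('I_n -> V) -> R) :=
  pseudo_nnorm N /\ forall x, N x = 0 <-> lin_dependent x.

Record pseudo_nmetric (T : Type) n (d : ('I_n -> T) -> R) : Prop :=
  PseudoNMetric {
  pseudo_nmetric_eq : forall x (i j : 'I_n), i != j -> x i = x j -> d x = 0 ;
  pseudo_nmetric_perm : forall x (s : 'S_n), d (fun i => x (s i)) = d x ;
  pseudo_nmetric_simplex : forall x y,
    d x <= \sum_(i < n) d [eta x with i |-> y] }.

End NNorm.

(* Main.v *)
(** The map (x_1, ..., x_n) |-> x_1 /\ ... /\ x_n is multilinear and alternating,
    so everything but definiteness and the simplex inequality is immediate.
    Definiteness: for independent x_0, ..., x_k and functionals f_1, ..., f_k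
    not annihilating x_1 /\ ... /\ x_k, expanding along the row of a further
    functional g gives g (z) with z = sum_j c_j x_j and c_0 <> 0, so z <> 0 and
    Hahn-Banach provides a suitable g.  Hahn-Banach is obtained by showing that
    a minimal sublinear functional is linear.
    Simplex inequality: det (f_i (x_j - x_0)) equals the determinant of
    (f_i (x_j)) bordered by a row of ones, and Cramer's rule shows that, for a
    column with entry 1 in that row, the determinants obtained by putting it in
    place of each column in turn add up to the original determinant. *)

Require Import Defs.
From mathcomp Require Import all_boot all_order all_algebra perm.
From mathcomp Require Import all_classical all_reals all_analysis.

Set Implicit Arguments.
Unset Strict Implicit.
Unset Printing Implicit Defensive.

Import Order.TTheory GRing.Theory Num.Theory.
Import numFieldNormedType.Exports.

Local Open Scope classical_set_scope.
Local Open Scope ring_scope.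

(** * Hahn-Banach: linear functionals below sublinear ones *)

Section Sublinear.
Context {R : realType} {V : lmodType R}.
Implicit Types (p q g : V -> R) (x y z : V).

(** Homogeneity is asked only as an inequality for positive [c]; using it at [c^-1] as well gives
    equality. *)
Record sublinear q : Prop := Sublinear {
  sublinearD : forall x y, q (x + y) <= q x + q y ;
  sublinearZ_le : forall c x, 0 < c -> q (c *: x) <= c * q x }.

Lemma sublinearZ q c x : sublinear q -> 0 < c -> q (c *: x) = c * q x.
Proof.
move=> [_ qZ] c0; apply/eqP; rewrite eq_le qZ//=.
rewrite mulrC -ler_pdivlMr// mulrC.
by rewrite -{1}[x](scalerK (lt0r_neq0 c0)) qZ// invr_gt0.
Qed.

Lemma sublinear0 q : sublinear q -> q 0 = 0.
Proof.
move=> sq; have := sublinearZ 0 sq (ltr0Sn R 1).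
rewrite scaler0 mulr_natl mulr2n => /eqP.
by rewrite -subr_eq0 opprD addNKr oppr_eq0 => /eqP.
Qed.

Lemma sublinear_lower q x : sublinear q -> - q (- x) <= q x.
Proof.
by move=> sq; rewrite lerNl -subr_ge0 opprK addrC -(sublinear0 sq)
  -(subrr x) sublinearD.
Qed.

(** Oddness reverses subadditivity: [q x <= q (x + y) + q (- y)]. *)
Lemma sublinear_odd_linear q : sublinear q -> (forall x, q (- x) = - q x) ->
  linear q.
Proof.
move=> sq qN.
have qD x y : q (x + y) = q x + q y.
  apply/eqP; rewrite eq_le (sublinearD sq)/= -lerBrDr -qN.
  by rewrite -{1}[x](addrK y) (sublinearD sq).
move=> a x y; rewrite qD; congr (_ + _).
have [a0|a0|->] := ltgtP a 0; last by rewrite !scale0r sublinear0.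
  rewrite -[a]opprK scaleNr qN sublinearZ ?oppr_gt0//.
  by rewrite -mulNr.
by rewrite sublinearZ.
Qed.

Definition pointwise_inf (G : set (V -> R)) x : R := inf [set g x | g in G].

Lemma pointwise_inf_le (G : set (V -> R)) l g x :
  (forall h y, G h -> l y <= h y) -> G g -> pointwise_inf G x <= g x.
Proof.
move=> Gl Gg; apply: ge_inf; last by exists g.
by exists (l x) => _ [h Gh <-]; exact: Gl.
Qed.

Lemma le_pointwise_inf (G : set (V -> R)) c x :
  G !=set0 -> (forall g, G g -> c <= g x) -> c <= pointwise_inf G x.
Proof.
move=> [g Gg] Gc; apply: lb_le_inf; first by exists (g x), g.
by move=> _ [h Gh <-]; exact: Gc.
Qed.

(** The common lower bound [l] keeps the infima finite. Members of [G] may fail to be sublinear, so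
    the family defining [tilt] is covered as well as chains. *)
Lemma sublinear_pointwise_inf (G : set (V -> R)) l : G !=set0 ->
  (forall h y, G h -> l y <= h y) ->
  (forall g h x y, G g -> G h -> exists2 k, G k & k (x + y) <= g x + h y) ->
  (forall g c x, G g -> 0 < c -> exists2 k, G k & k (c *: x) <= c * g x) ->
  sublinear (pointwise_inf G).
Proof.
move=> G0 Gl GD GZ; split=> [x y|c x c0].
  rewrite -lerBlDr; apply: le_pointwise_inf => // g Gg.
  rewrite lerBlDl -lerBlDr; apply: le_pointwise_inf => // h Gh.
  rewrite lerBlDl; have [k Gk kle] := GD g h x y Gg Gh.
  apply: le_trans kle; exact: (pointwise_inf_le _ Gl).
rewrite mulrC -ler_pdivrMr//; apply: le_pointwise_inf => // g Gg.
rewrite ler_pdivrMr// mulrC; have [k Gk kle] := GZ g c x Gg c0.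
apply: le_trans kle; exact: (pointwise_inf_le _ Gl).
Qed.

(* The largest sublinear functional below q whose value at - z is at most
   - q z. *)
Definition tilt z q : V -> R :=
  pointwise_inf [set (fun x => q (x + t *: z) - t * q z) | t in [set t | 0 <= t]].

Section Tilt.
Variables (z : V) (q : V -> R).
Hypothesis sq : sublinear q.

(** Subadditivity for [t *: z = - x + (x + t *: z)] gives a bound free of [t]. *)
Let lower x t : 0 <= t -> - q (- x) <= q (x + t *: z) - t * q z.
Proof.
move=> t0; have -> : t * q z = q (t *: z).
  move: t0; rewrite le_eqVlt => /predU1P[<-|t0].
    by rewrite mul0r scale0r sublinear0.
  by rewrite sublinearZ.
rewrite lerBrDr addrC lerBlDr.
by rewrite -{1}[t *: z](addKr x) addrC sublinearD.
Qed.

Lemma tilt_le_at t x : 0 <= t -> tilt z q x <= q (x + t *: z) - t * q z.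
Proof.
move=> t0; apply: (@pointwise_inf_le _ (fun x => - q (- x))
  (fun x => q (x + t *: z) - t * q z)); last by exists t.
by move=> _ y [s /= s0 <-]; exact: lower.
Qed.

Lemma tilt_le x : tilt z q x <= q x.
Proof. by have := tilt_le_at x (lexx 0); rewrite scale0r addr0 mul0r subr0. Qed.

Lemma tiltN_le : tilt z q (- z) <= - q z.
Proof.
have := tilt_le_at (- z) ler01.
by rewrite scale1r addNr sublinear0// mul1r sub0r.
Qed.

Lemma sublinear_tilt : sublinear (tilt z q).
Proof.
apply: (@sublinear_pointwise_inf _ (fun x => - q (- x))).
- by exists (fun x => q (x + 0 *: z) - 0 * q z), 0; rewrite /= ?lexx.
- by move=> _ y [s /= s0 <-]; exact: lower.
- move=> _ _ x y [s /= s0 <-] [t /= t0 <-].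
  exists (fun x => q (x + (s + t) *: z) - (s + t) * q z).
    by exists (s + t) => //=; rewrite addr_ge0.
  by rewrite scalerDl mulrDl addrACA opprD [leRHS]addrACA lerD2r sublinearD.
- move=> _ c x [s /= s0 <-] c0.
  exists (fun x => q (x + (c * s) *: z) - (c * s) * q z).
    by exists (c * s) => //=; rewrite mulr_ge0// ltW.
  by rewrite -scalerA -scalerDr sublinearZ// -mulrA -mulrBr.
Qed.

End Tilt.

(** Zorn's lemma for the reversed pointwise order; a nonempty chain is bounded by its pointwise
    infimum. *)
Lemma minimal_sublinear p : sublinear p -> exists q,
  [/\ sublinear q, (forall x, q x <= p x) &
    forall g, sublinear g -> (forall x, g x <= q x) -> g = q].
Proof.
move=> sp; pose P q := `[< sublinear q /\ forall x, q x <= p x >].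
pose T := {q | P q}; pose r (a b : T) := `[< forall x, val b x <= val a x >].
(* This bound, common to all sublinear functionals below [p], keeps infima over chains finite. *)
have lowerT (a : T) x : - p (- x) <= val a x.
  have /asboolP[sa ap] := valP a.
  by rewrite (le_trans _ (sublinear_lower x sa))// lerN2.
have [||||[q Pq] qmin] := @Zorn T r.
- by move=> a; apply/asboolP.
- move=> a b c /asboolP ab /asboolP bc; apply/asboolP => x.
  exact: le_trans (bc x) (ab x).
- move=> a b /asboolP ab /asboolP ba; apply/val_inj/funext => x.
  by apply/eqP; rewrite eq_le ab ba.
- move=> A Atot; have [->|/set0P[a0 Aa0]] := eqVneq A set0.
    suff Pp : P p by exists (Sub p Pp).
    by apply/asboolP; split.
  pose G : set (V -> R) := [set val a | a in A].
  have Gl h y : G h -> - p (- y) <= h y by move=> [a _ <-].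
  have sG : sublinear (pointwise_inf G).
    apply: (sublinear_pointwise_inf _ Gl); first by exists (val a0), a0.
    + move=> _ _ x y [a Aa <-] [b Ab <-].
      have /asboolP[[aD _] _] := valP a; have /asboolP[[bD _] _] := valP b.
      (* Of two comparable members, the smaller serves for both arguments. *)
      have [/asboolP ab|/asboolP ba] := Atot a b Aa Ab.
        exists (val b); first by exists b.
        by rewrite (le_trans (bD _ _))// lerD2r.
      exists (val a); first by exists a.
      by rewrite (le_trans (aD _ _))// lerD2l.
    + move=> _ c x [a Aa <-] c0; exists (val a); first by exists a.
      by have /asboolP[[_ +] _] := valP a; exact.
  have PG : P (pointwise_inf G).
    apply/asboolP; split=> // x.
    have /asboolP[_ /(_ x)] := valP a0; apply: le_trans.
    by apply: (pointwise_inf_le _ Gl); exists a0.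
  exists (Sub _ PG) => a Aa; apply/asboolP => x /=.
  by apply: (pointwise_inf_le _ Gl); exists a.
- have /asboolP[sq qp] := Pq; exists q; split=> // g sg gq.
  have Pg : P g by apply/asboolP; split=> // x; exact: le_trans (gq x) (qp x).
  have rg : r (exist _ q Pq) (exist _ g Pg) by apply/asboolP => x; exact: gq.
  by have [] := qmin _ rg.
Qed.

Lemma linear_below_sublinear p : sublinear p ->
  exists2 q : V -> R, linear q & forall x, q x <= p x.
Proof.
move=> /minimal_sublinear[q [sq qp qmin]]; exists q => //.
apply: sublinear_odd_linear => // z; apply/eqP; rewrite eq_le.
apply/andP; split; last by rewrite lerNl sublinear_lower.
(* Minimality gives [tilt z q = q], hence [q (- z) <= - q z]. *)
by have := tiltN_le z sq; rewrite (qmin _ (sublinear_tilt z sq) (tilt_le z sq)).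
Qed.

End Sublinear.

(** * Continuous functionals separate points *)

Section SeparatingDual.
Context {R : realType} {X : normedModType R}.

Lemma linear_contraction_clinear (f : X -> R) :
  linear f -> (forall x, f x <= `|x|) -> f \in @clinear _ X.
Proof.
move=> lf fle; rewrite inE; split=> // x.
have fB u v : f (u - v) = f u - f v.
  by rewrite -[in LHS]addrC -scaleN1r lf scaleN1r addrC.
apply/cvgrPdist_lt => e e0; near=> y.
rewrite (@le_lt_trans _ _ `|x - y|)//.
by rewrite ler_norml -fB fle lerNl fB opprB -fB distrC fle.
Unshelve. all: by end_near. Qed.

(** A linear functional below the norm tilted at [z] is negative at [- z]. *)
Lemma dual_separates (z : X) : z != 0 -> exists f : dual_space X, f z != 0.
Proof.
move=> z0; have sn : sublinear (fun x : X => `|x|).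
  by split=> [|c x c0]; [exact: ler_normD|rewrite normrZ gtr0_norm].
have [q lq qle] := linear_below_sublinear (sublinear_tilt z sn).
have qn x : q x <= `|x| := le_trans (qle x) (tilt_le z sn x).
exists (Dual (linear_contraction_clinear lq qn)) => /=.
have : q (- z) < 0.
  by rewrite (le_lt_trans (le_trans (qle _) (tiltN_le z sn)))// oppr_lt0 normr_gt0.
apply: contraTneq => qz0.
have q0 : q 0 = 0.
  by have /= := lq (-1) 0 0; rewrite scaler0 addr0 scaleN1r addNr.
by have /= := lq (-1) z 0; rewrite scaleN1r addr0 qz0 scaler0 q0 addr0 => ->;
  rewrite ltxx.
Qed.

End SeparatingDual.

(** * Determinant identities *)

Section Determinants.
Context {R : comNzRingType}.

Lemma det_col_perm n (s : 'S_n) (A : 'M[R]_n) :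
  \det (col_perm s A) = (-1) ^+ s * \det A.
Proof. by rewrite col_permE det_mulmx det_perm odd_permV mulrC. Qed.

(** The cofactors along column [j] do not see that column. *)
Lemma det_replace_col n (A : 'M[R]_n) (c : 'I_n -> R) j :
  \det (\matrix_(p, q) if q == j then c p else A p q) =
  \sum_p c p * cofactor A p j.
Proof.
rewrite (expand_det_col _ j); apply: eq_bigr => p _; rewrite mxE eqxx.
congr (_ * (_ * \det _)); apply/matrixP => a b.
by rewrite !mxE eq_sym (negbTE (neq_lift _ _)).
Qed.

(** Cramer's rule without division: row [i] of [A *m \adj A] applied to the column [c]. *)
Lemma sum_det_replace_col n (A : 'M[R]_n) (c : 'I_n -> R) i :
  \sum_j A i j * \det (\matrix_(p, q) if q == j then c p else A p q) =
  c i * \det A.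
Proof.
under eq_bigr do rewrite det_replace_col mulr_sumr.
rewrite exchange_big/=.
have E p : \sum_j A i j * (c p * cofactor A p j) = c p * (A *m \adj A) i p.
  by rewrite mxE mulr_sumr; apply: eq_bigr => j _; rewrite mulrCA !mxE.
under eq_bigr do rewrite E mul_mx_adj mxE.
rewrite (bigD1 i)//= eqxx mulr1n big1 ?addr0// => p pi.
by rewrite eq_sym (negbTE pi) mulr0n mulr0.
Qed.

Lemma det_row1 m (B : 'M[R]_m.+1) : (forall j, B ord0 j = 1) ->
  \det B = \det (\matrix_(i < m, j < m)
    (B (lift ord0 i) (lift ord0 j) - B (lift ord0 i) ord0)).
Proof.
move=> B1; pose B' : 'M[R]_(1 + m) := B.
(* Right multiplication by [C] subtracts the first column from the others, clearing the row of ones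
   after its first entry. *)
pose C : 'M[R]_(1 + m) := block_mx 1%:M (const_mx (-1)) 0 1%:M.
have <- : \det (B' *m C) = \det B.
  by rewrite det_mulmx /C det_ublock !det1 !mulr1.
rewrite -(submxK B') /C mulmx_block !mulmx1 !mulmx0 !addr0.
have lshiftE : lshift m (0 : 'I_1) = ord0 :> 'I_m.+1 by exact/val_inj.
have rshiftE i : rshift 1 i = lift ord0 i :> 'I_m.+1 by exact/val_inj.
have -> : ulsubmx B' *m const_mx (-1) + ursubmx B' = 0.
  apply/matrixP => i j; rewrite !mxE big_ord1 !mxE (ord1 i) /B' lshiftE !B1.
  by rewrite mul1r addNr.
rewrite det_lblock det_mx11 !mxE /B' lshiftE B1 mul1r.
congr (\det _); apply/matrixP => i j.
by rewrite !mxE big_ord1 !mxE lshiftE !rshiftE mulrN1 addrC.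
Qed.

End Determinants.

(** * Linear dependence detected by functionals *)

Section LinDependent.
Context {R : realType} {X : normedModType R}.
Implicit Types (n k m : nat).

Lemma det_lin_dependent n (f : 'I_n -> dual_space X) (x : 'I_n -> X) :
  lin_dependent x -> \det (\matrix_(i, j) f i (x j)) = 0.
Proof.
move=> [a [[i ai0] ax0]]; apply/eqP; rewrite -det_tr; apply/det0P.
exists (\row_j a j).
  by apply: contraNneq ai0 => /rowP/(_ i); rewrite !mxE => ->.
apply/rowP => p; rewrite !mxE -[RHS](linear0 (f p)) -ax0 linear_sum.
by apply: eq_bigr => j _; rewrite !mxE linearZ.
Qed.

Lemma det_dual_neq0 n (x : 'I_n -> X) : ~ lin_dependent x ->
  exists f : 'I_n -> dual_space X, \det (\matrix_(i, j) f i (x j)) != 0.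
Proof.
elim: n x => [|n IH] x xfree.
  by exists (fun=> 0); rewrite det_mx00 oner_neq0.
have [|f fdet] := IH (fun j => x (lift ord0 j)).
  move=> [a [[i ai0] ax0]]; apply: xfree.
  (* A dependence among the last [n] vectors extends by the coefficient 0 at [ord0]. *)
  exists (fun j => oapp a 0 (unlift ord0 j)); split.
    by exists (lift ord0 i); rewrite liftK.
  rewrite big_ord_recl unlift_none scale0r add0r -[RHS]ax0.
  by apply: eq_bigr => j _; rewrite liftK.
pose F g (i : 'I_n.+1) := oapp f g (unlift ord0 i).
pose A g : 'M[R]_n.+1 := \matrix_(i, j) F g i (x j).
(* Cofactors along the first row ignore that row, so [A 0] serves for every [g]. *)
pose z := \sum_j cofactor (A 0) ord0 j *: x j.
have detF g : \det (A g) = g z.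
  rewrite (expand_det_row _ ord0) linear_sum; apply: eq_bigr => j _.
  rewrite linearZ mulrC mxE /F unlift_none/=; congr (_ * _ * _); congr (\det _).
  by apply/matrixP => p q; rewrite !mxE /F liftK.
have [g gz] : exists g : dual_space X, g z != 0.
  apply: dual_separates; apply/eqP => z0; apply: xfree.
  exists (cofactor (A 0) ord0); split=> //; exists ord0.
  (* The cofactor at [ord0] is the minor that [f] makes nonzero. *)
  rewrite /cofactor addn0 expr0 mul1r; move: fdet; congr (\det _ != 0).
  by apply/matrixP => p q; rewrite !mxE /F liftK.
by exists (F g); rewrite -/(A g) detF.
Qed.

End LinDependent.

(** * Vanishing, symmetry and multilinearity of exterior products *)

Section ExteriorPower.
Context {R : realType} {X : normedModType R} {n : nat}.
Implicit Types (u v : extpow n X) (x : 'I_n -> X) (f : 'I_n -> dual_space X).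

Lemma extpowP u v : (forall f, u f = v f) -> u = v.
Proof. by move=> uv; apply/val_inj/val_inj/funext. Qed.

Lemma extpow_scaleE a u f : (a *: u) f = a * u f.
Proof. by []. Qed.

Lemma extpow_linearE a u v f : (a *: u + v) f = a * u f + v f.
Proof. by []. Qed.

Lemma extpow_sumE I (s : seq I) (P : pred I) (F : I -> extpow n X) f :
  (\sum_(i <- s | P i) F i) f = \sum_(i <- s | P i) F i f.
Proof. exact: (big_morph (fun u : extpow n X => u f)). Qed.

Lemma extprodE x f : extprod x f = \det (\matrix_(i, j) f i (x j)).
Proof. by []. Qed.

Lemma extprod_eq0 x : extprod x = 0 <-> lin_dependent x.
Proof.
split=> [x0|dx]; last by apply: extpowP => f; rewrite extprodE det_lin_dependent.
apply: contrapT => /det_dual_neq0[f]; rewrite -extprodE x0.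
by rewrite eqxx.
Qed.

Lemma extprod_perm x (s : 'S_n) :
  extprod (fun i => x (s i)) = (-1) ^+ s *: extprod x.
Proof.
apply: extpowP => f; rewrite extpow_scaleE !extprodE -det_col_perm.
by congr (\det _); apply/matrixP => p q; rewrite !mxE.
Qed.

Lemma extprod_linear x i a y z : extprod [eta x with i |-> a *: y + z] =
  a *: extprod [eta x with i |-> y] + extprod [eta x with i |-> z].
Proof.
apply: extpowP => f; rewrite extpow_linearE !extprodE.
(* [determinant_multilinear] concerns rows, while the vectors index columns. *)
rewrite -det_tr -(det_tr (\matrix_(_, _) _)) -[X in _ = _ + X]det_tr.
rewrite -[X in _ = _ + X]mul1r.
apply: (@determinant_multilinear _ _ _ _ _ i).
- by apply/rowP => j; rewrite !mxE/= eqxx mul1r linearP.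
- by apply/matrixP => p q; rewrite !mxE/= eq_sym (negbTE (neq_lift _ _)).
- by apply/matrixP => p q; rewrite !mxE/= eq_sym (negbTE (neq_lift _ _)).
Qed.

Lemma extprodZ x i a y : extprod [eta x with i |-> a *: y] =
  a *: extprod [eta x with i |-> y].
Proof.
have E0 : extprod [eta x with i |-> 0] = 0.
  (* This instance has the shape [w = w + w]. *)
  have := extprod_linear x i 1 0 0; rewrite !scale1r addr0 => /eqP.
  by rewrite -subr_eq0 opprD addNKr oppr_eq0 => /eqP.
by have := extprod_linear x i a y 0; rewrite E0 !addr0.
Qed.

Lemma extprodD x i y z : extprod [eta x with i |-> y + z] =
  extprod [eta x with i |-> y] + extprod [eta x with i |-> z].
Proof. by rewrite -[y in LHS]scale1r extprod_linear scale1r. Qed.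

End ExteriorPower.

(** * Exterior products of the edges of a simplex *)

Section Simplex.
Context {R : realType} {X : normedModType R} {m : nat}.
Implicit Types (x : 'I_m.+1 -> X) (f : 'I_m -> dual_space X).

Definition edges x (i : 'I_m) := x (lift ord0 i) - x ord0.

(* Unlike the edges, the columns of this matrix play symmetric roles. *)
Definition simplex_mx f x : 'M[R]_m.+1 :=
  \matrix_(i, j) oapp (fun p => f p (x j)) 1 (unlift ord0 i).

Lemma extprod_edgesE x f : extprod (edges x) f = \det (simplex_mx f x).
Proof.
rewrite det_row1 => [|j]; last by rewrite mxE unlift_none.
rewrite extprodE; congr (\det _); apply/matrixP => p q.
by rewrite !mxE !liftK/= linearB.
Qed.

(** Equal vertices give equal columns of [simplex_mx], the base vertex included. *)
Lemma extprod_edges_eq x i j : i != j -> x i = x j -> extprod (edges x) = 0.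
Proof.
move=> ij xij; apply: extpowP => f; rewrite extprod_edgesE -det_tr.
by apply: (determinant_alternate ij) => p; rewrite !mxE xij.
Qed.

Lemma extprod_edges_perm x (s : 'S_m.+1) :
  extprod (edges (fun i => x (s i))) = (-1) ^+ s *: extprod (edges x).
Proof.
apply: extpowP => f; rewrite extpow_scaleE !extprod_edgesE -det_col_perm.
by congr (\det _); apply/matrixP => p q; rewrite !mxE.
Qed.

(** An exact identity of signed volumes; the triangle inequality then yields the simplex
    inequality. *)
Lemma extprod_edges_simplex x y :
  extprod (edges x) = \sum_i extprod (edges [eta x with i |-> y]).
Proof.
apply: extpowP => f; rewrite extpow_sumE extprod_edgesE.
(* The column contributed by [y]. The weights in the Cramer sum are the entries of row [ord0], all
   equal to 1. *)
pose c p : R := oapp (fun q => f q y) 1 (unlift ord0 p).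
have := sum_det_replace_col (simplex_mx f x) c ord0.
rewrite /c unlift_none mul1r => <-; apply: eq_bigr => j _.
rewrite extprod_edgesE mxE unlift_none mul1r; congr (\det _).
apply/matrixP => p q; by rewrite !mxE/=; case: ifPn.
Qed.

End Simplex.

(** * Consequences of the norm axioms *)

Section Norm.
Context {R : realType} {V : lmodType R} (N : V -> R).
Hypothesis nN : is_norm N.

Lemma is_norm0 : N 0 = 0.
Proof. by rewrite -(scale0r 0) (is_norm_scale nN) normr0 mul0r. Qed.

Lemma is_norm_eq0 v : N v = 0 <-> v = 0.
Proof. by split=> [/(is_norm_definite nN)//|->]; exact: is_norm0. Qed.

Lemma is_norm_sign (b : bool) v : N ((-1) ^+ b *: v) = N v.
Proof. by rewrite (is_norm_scale nN) normrX normrN1 expr1n mul1r. Qed.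

Lemma is_norm_sum I (s : seq I) (F : I -> V) :
  N (\sum_(i <- s) F i) <= \sum_(i <- s) N (F i).
Proof.
apply: (big_ind2 (fun v r => N v <= r)) => //; first by rewrite is_norm0.
by move=> u a v b ua vb; rewrite (le_trans (is_norm_triangle nN _ _))// lerD.
Qed.

End Norm.

Theorem proposition3p6 (R : realType) (X : completeNormedModType R)
    (sepX : separable_space X) (reflX : reflexive_space X) :
  (forall (n : nat) (N : extpow n X -> R), (1 <= n)%N -> is_norm N ->
     is_nnorm (fun x : 'I_n -> X => N (extprod x)))
  /\
  (forall (m : nat) (N : extpow m X -> R), (2 <= m.+1)%N -> is_norm N ->
     let v (x : 'I_m.+1 -> X) := fun i : 'I_m => x (lift ord0 i) - x ord0 in
     let d (x : 'I_m.+1 -> X) := N (extprod (v x)) in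
     pseudo_nmetric d /\ forall x, d x = 0 <-> lin_dependent (v x)).
Proof.
have Neq0 k (N : extpow k X -> R) (x : 'I_k -> X) : is_norm N ->
    N (extprod x) = 0 <-> lin_dependent x.
  by move=> nN; rewrite is_norm_eq0// extprod_eq0.
split=> [n N _ nN|m N _ nN v d].
  (* This recovers [x] from the updated families produced by multilinearity. *)
  have replace_id (x : 'I_n -> X) i : [eta x with i |-> x i] = x :> ('I_n -> X).
    by apply/funext => j /=; case: eqP => [->|].
  split; last by move=> x; exact: Neq0.
  split=> [x|x s|x i a _|x i y _].
  - by move/Neq0; exact.
  - by rewrite extprod_perm is_norm_sign.
  - by rewrite extprodZ is_norm_scale// replace_id.
  - by rewrite extprodD replace_id is_norm_triangle.
split; last by move=> x; exact: Neq0.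
split=> [x i j ij xij|x s|x y].
(* [v x] is [edges x] by conversion. *)
- by rewrite /d (extprod_edges_eq ij xij) is_norm0.
- by rewrite /d (extprod_edges_perm x s) is_norm_sign.
- by rewrite /d (extprod_edges_simplex x y) is_norm_sum.
Qed.
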